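(* Let $G$ be a grid diagram. The filtered chain complex $(\widetilde{C}^-(G),\widetilde{\partial}^-)$ is filtered isomorphic to the filtered chain complex $(C^-(G),\partial^-)$ with coefficients in $\mathbb{Z}$, where the signs in $\partial^-$ are given by the sign assignment $\mathbf{S}(r)=\varepsilon(r)\cdot c(\mathbf{x},\mathbf{x}^{-1}.\mathbf{y})$ for $r\in\mathrm{Rect}^\circ(\mathbf{x},\mathbf{y})$.
   Context: Grid diagrams. A grid diagram $G$ of complexity $n$ is an $n\times n$ array of unit squares, placed in the plane as $[0,n]\times[0,n]$, each square being decorated (at its centre) with an $X$, an $O$ or nothing, so that each row and each column contains exactly one $X$ and exactly one $O$. Number the markings: $\mathbb{X}=\{X_i\}_{i=1}^n$, $\mathbb{O}=\{O_i\}_{i=1}^n$. Drawing horizontal segments from the $O$ to the $X$ in each row and vertical segments from the $X$ to the $O$ in each column, verticals passing over horizontals, gives an oriented link $\overrightarrow{L}$. Number its components from $1$ to $l$; let $\mathbb{O}_i\subset\mathbb{O}$, $\mathbb{X}_i\subset\mathbb{X}$ be the markings on the $i$-th component and $n_i$ the number of horizontal segments on it. Identify opposite sides of the square to get an oriented torus $\mathcal{T}$. Groups. $\mathfrak{S}_n$ is the group of bijections of $\{0,\dots,n-1\}$, with product $(x.y)(i)=x(y(i))$, $\tau_{i,j}$ is the transposition of $i$ and $j$ ($\tau_{i,i}=1$), and $\tau_i=\tau_{i,i+1}$. $\widetilde{\mathfrak{S}}_n$ is the group with generators $\widetilde{\tau}_0,\dots,\widetilde{\tau}_{n-2},z$ and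 relations $z^2=1$, $z\widetilde{\tau}_i=\widetilde{\tau}_iz$, $\widetilde{\tau}_i^2=z$, $\widetilde{\tau}_i\widetilde{\tau}_j=z\widetilde{\tau}_j\widetilde{\tau}_i$ for $|i-j|>1$, $\widetilde{\tau}_i\widetilde{\tau}_{i+1}\widetilde{\tau}_i=\widetilde{\tau}_{i+1}\widetilde{\tau}_i\widetilde{\tau}_{i+1}$. It is a central extension of $\mathfrak{S}_n$ by $\{1,z\}\cong\mathbb{Z}/2\mathbb{Z}$ via $p:\widetilde{\tau}_i\mapsto\tau_i$, $z\mapsto1$; write $\mathbf{x}=p(\widetilde{\mathbf{x}})$. For $i<j$ put $\widetilde{\tau}_{i,j}=\widetilde{\tau}_i\widetilde{\tau}_{i+1}\cdots\widetilde{\tau}_{j-2}\widetilde{\tau}_{j-1}\widetilde{\tau}_{j-2}\cdots\widetilde{\tau}_{i+1}\widetilde{\tau}_i$, $\widetilde{\tau}_{j,i}=z\widetilde{\tau}_{i,j}$, and $\widetilde{\tau}_{i,i}=1$. The section $s$ and cocycle $c$. Every $\mathbf{x}\in\mathfrak{S}_n$ is written uniquely as $\mathbf{x}=\tau_{i_0,0}.\tau_{i_1,1}.\cdots.\tau_{i_{n-1},n-1}$ with $0\le i_k\le k$. Set $s(\mathbf{x})=\widetilde{\tau}_{i_0,0}.\widetilde{\tau}_{i_1,1}.\cdots.\widetilde{\tau}_{i_{n-1},n-1}$. The 2-cocycle $c:\mathfrak{S}_n\times\mathfrak{S}_n\to\{\pm1\}$ is defined by $s(\mathbf{x}).s(\mathbf{y})=\iota(c(\mathbf{x},\mathbf{y}))\,s(\mathbf{x}.\mathbf{y})$,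 where $\iota(1)=1$, $\iota(-1)=z$. Gradings. $\mathbf{x}\in\mathfrak{S}_n$ is identified with its graph, the set of points $(i,\mathbf{x}(i))$, $0\le i\le n-1$. For finite sets $A,B$ of points in the plane, $\mathcal{I}(A,B)$ is the number of pairs $(a_1,a_2)\in A$, $(b_1,b_2)\in B$ with $a_1<b_1$ and $a_2<b_2$; $\mathcal{J}(A,B)=(\mathcal{I}(A,B)+\mathcal{I}(B,A))/2$, extended bilinearly to formal sums and differences. The Maslov degree is $M(\mathbf{x})=\mathcal{J}(\mathbf{x}-\mathbb{O},\mathbf{x}-\mathbb{O})+1$. The Alexander filtration level is $A(\mathbf{x})=(A_1(\mathbf{x}),\dots,A_l(\mathbf{x}))$ with $A_i(\mathbf{x})=\mathcal{J}(\mathbf{x}-\frac12(\mathbb{X}+\mathbb{O}),\mathbb{X}_i-\mathbb{O}_i)-\frac{n_i-1}{2}$. Put $M(\widetilde{\mathbf{x}})=M(\mathbf{x})$, $A(\widetilde{\mathbf{x}})=A(\mathbf{x})$. Each variable $U_{O_j}$ has Maslov degree $-2$ and $A(U_{O_j})=(0,\dots,0,-1,0,\dots,0)$ with $-1$ in position $i$ if $O_j$ lies on the $i$-th component; both are additive under multiplication by monomials. Filtration levels carry the componentwise partial order. Rectangles. For $\mathbf{x}\in\mathfrak{S}_n$ and an ordered pair $i\ne j$, there is a rectangle $r$ from $\mathbf{x}$ to $\mathbf{y}=\mathbf{x}.\tau_{i,j}$, embedded in $\mathcal{T}$ with bottom left corner $(i,\mathbf{x}(i))$ and top right corner $(j,\mathbf{x}(j))$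 (going rightwards from column $i$ to column $j$ and upwards from $\mathbf{x}(i)$ to $\mathbf{x}(j)$, cyclically). These are all the rectangles from $\mathbf{x}$ to $\mathbf{y}$. It is empty if its interior contains no point of $\mathbf{x}$; $\mathrm{Rect}^\circ(\mathbf{x},\mathbf{y})$ is the set of empty rectangles from $\mathbf{x}$ to $\mathbf{y}$, and $O_k(r)$ is the number of times $O_k$ appears in the interior of $r$. The rectangle $r$ is horizontally torn if the first coordinate (in $\{0,\dots,n-1\}$) of its bottom left corner is larger than that of its top right corner; $\varepsilon(r)=-1$ if $r$ is horizontally torn and $\varepsilon(r)=+1$ otherwise. At the level of $\widetilde{\mathfrak{S}}_n$, $\widetilde{\tau}_{i,j}$ is regarded as a rectangle $\widetilde r$ from $\widetilde{\mathbf{x}}$ to $\widetilde{\mathbf{y}}=\widetilde{\mathbf{x}}.\widetilde{\tau}_{i,j}$, whose corresponding rectangle $r$ in $\mathcal{T}$ is the one given by $\mathbf{x}$ and $(i,j)$; $\widetilde r$ is empty if $r$ is, $O_k(\widetilde r)=O_k(r)$, and $\mathrm{Rect}^\circ(\widetilde{\mathbf{x}},\widetilde{\mathbf{y}})$ is the set of empty rectangles from $\widetilde{\mathbf{x}}$ to $\widetilde{\mathbf{y}}$. Complexes. With $\Lambda=\mathbb{Z}[U_{O_1},\dots,U_{O_n}]$, $\widetilde{C}^-(G)=\Lambda[\widetilde{\mathfrak{S}}_n]/\langle z+1\rangle$ is the quotient of the free $\Lambda$-module on $\widetilde{\mathfrak{S}}_n$ by the submodule generated by $z+1$ (so $z\widetilde{\mathbf{x}}=-\widetilde{\mathbf{x}}$),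 with $\Lambda$-linear differential $$\widetilde{\partial}^-\widetilde{\mathbf{x}}=\sum_{\widetilde{\mathbf{y}}\in\widetilde{\mathfrak{S}}_n}\ \sum_{\widetilde r\in\mathrm{Rect}^\circ(\widetilde{\mathbf{x}},\widetilde{\mathbf{y}})}U_{O_1}^{O_1(\widetilde r)}\cdots U_{O_n}^{O_n(\widetilde r)}\,\widetilde{\mathbf{y}}.$$ $C^-(G)$ with coefficients in $\mathbb{Z}$ is the free $\Lambda$-module on $\mathfrak{S}_n$ with $\Lambda$-linear differential $$\partial^-\mathbf{x}=\sum_{\mathbf{y}\in\mathfrak{S}_n}\ \sum_{r\in\mathrm{Rect}^\circ(\mathbf{x},\mathbf{y})}\mathbf{S}(r)\,U_{O_1}^{O_1(r)}\cdots U_{O_n}^{O_n(r)}\,\mathbf{y}.$$ Both are graded by $M$ and filtered by $A$; filtered isomorphic means that there is an isomorphism of chain complexes of $\Lambda$-modules respecting the grading and the filtration in both directions. *)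

(* Defs.v *)
From HB Require Import structures.
From mathcomp Require Import all_boot all_order all_algebra all_fingroup.
From mathcomp Require Import boolp classical_sets fsbigop.
From mathcomp Require Import zify finmap.
From mathcomp Require Import monalg mpoly generic_quotient.

Set Implicit Arguments.
Unset Strict Implicit.
Unset Printing Implicit Defensive.

Import Order.TTheory GRing.Theory Num.Theory.

Local Open Scope quotient_scope.
Local Open Scope classical_set_scope.
Local Open Scope ring_scope.

Local Notation "f @_ k" := (monalg.mcoeff k f) : ring_scope.
Local Notation supp := monalg.msupp.

(* A word is a list of letters (a, e) standing for a when e = false and for
   a^-1 when e = true. *)
Definition word (gen : Type) := seq (gen * bool).

Section Presentation.
Variables (gen : choiceType) (rels : word gen -> word gen -> Prop).

Inductive pres_eq : word gen -> word gen -> Prop :=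
| pres_refl w : pres_eq w w
| pres_sym v w : pres_eq v w -> pres_eq w v
| pres_trans u v w : pres_eq u v -> pres_eq v w -> pres_eq u w
| pres_ctx u v w1 w2 : pres_eq w1 w2 -> pres_eq (u ++ w1 ++ v) (u ++ w2 ++ v)
| pres_cancel a e : pres_eq [:: (a, e); (a, ~~ e)] [::]
| pres_rel w1 w2 : rels w1 w2 -> pres_eq w1 w2.

Definition pres_eqb (v w : word gen) : bool := `[< pres_eq v w >].

Lemma pres_eqb_is_equiv : equiv_class_of pres_eqb.
Proof.
split=> [w|v w|v u w].
- exact/asboolP/pres_refl.
- by apply/asboolP/asboolP; exact: pres_sym.
- by move=> /asboolP uv /asboolP vw; apply/asboolP; exact: pres_trans uv vw.
Qed.

Canonical pres_equiv := EquivRelPack pres_eqb_is_equiv.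
Canonical pres_encModRel := defaultEncModRel pres_eqb.

Definition presented := {eq_quot pres_eqb}.
HB.instance Definition _ : EqQuotient (word gen) pres_eqb presented :=
  EqQuotient.on presented.
HB.instance Definition _ := Choice.on presented.

Lemma pres_piP (v w : word gen) :
  pres_eq v w <-> \pi_presented v = \pi_presented w.
Proof.
split=> [vw|/eqP]; first by apply/eqP; rewrite eqmodE; apply/asboolP.
by rewrite eqmodE => /asboolP.
Qed.

Lemma pres_repr (w : word gen) : pres_eq (repr (\pi_presented w)) w.
Proof. by apply/pres_piP; rewrite reprK. Qed.

Lemma pres_cat (v1 v2 w1 w2 : word gen) :
  pres_eq v1 w1 -> pres_eq v2 w2 -> pres_eq (v1 ++ v2) (w1 ++ w2).
Proof.
move=> h1 h2; apply: (@pres_trans _ (w1 ++ v2)).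
  exact: (pres_ctx [::] v2 h1).
by have := pres_ctx w1 [::] h2; rewrite !cats0.
Qed.

Definition word_inv (w : word gen) : word gen :=
  rev [seq (l.1, ~~ l.2) | l <- w].

Lemma word_invK : involutive word_inv.
Proof.
move=> w; rewrite /word_inv map_rev revK -map_comp -[RHS]map_id.
by apply: eq_map => -[a e] /=; rewrite negbK.
Qed.

Lemma word_mulV (w : word gen) : pres_eq (w ++ word_inv w) [::].
Proof.
elim: w => [|[a e] w IHw]; first exact: pres_refl.
rewrite /word_inv /= rev_cons -/(word_inv w) -cats1 catA.
apply: pres_trans (pres_cancel a e).
exact: (pres_ctx [:: (a, e)] [:: (a, ~~ e)] IHw).
Qed.

Lemma word_inv_compat (v w : word gen) :
  pres_eq v w -> pres_eq (word_inv v) (word_inv w).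
Proof.
move=> vw; apply: (@pres_trans _ (word_inv v ++ (w ++ word_inv w))).
  apply: pres_sym; rewrite -[X in pres_eq _ X]cats0.
  by apply: pres_cat (word_mulV w); exact: pres_refl.
rewrite catA -[X in pres_eq _ X]cat0s; apply: pres_cat; last exact: pres_refl.
apply: (@pres_trans _ (word_inv v ++ v)).
  by apply: pres_cat; [exact: pres_refl|exact: pres_sym].
by rewrite -{2}[v]word_invK; exact: word_mulV.
Qed.

Definition pres_one : presented := \pi_presented [::].
Definition pres_mul (g h : presented) : presented := \pi_presented (repr g ++ repr h).
Definition pres_inv (g : presented) : presented := \pi_presented (word_inv (repr g)).

Lemma pres_mul_pi (v w : word gen) :
  pres_mul (\pi_presented v) (\pi_presented w) = \pi_presented (v ++ w).
Proof. by apply/pres_piP; apply: pres_cat; exact: pres_repr. Qed.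

Lemma pres_inv_pi (w : word gen) :
  pres_inv (\pi_presented w) = \pi_presented (word_inv w).
Proof. by apply/pres_piP/word_inv_compat/pres_repr. Qed.

Lemma pres_mulA : associative pres_mul.
Proof.
elim/quotW=> u; elim/quotW=> v; elim/quotW=> w.
by rewrite (pres_mul_pi v w) (pres_mul_pi u v) !pres_mul_pi catA.
Qed.

Lemma pres_mul1g : left_id pres_one pres_mul.
Proof. by elim/quotW=> w; rewrite pres_mul_pi. Qed.

Lemma pres_mulg1 : right_id pres_one pres_mul.
Proof. by elim/quotW=> w; rewrite pres_mul_pi cats0. Qed.

Lemma pres_mulgV : right_inverse pres_one pres_inv pres_mul.
Proof.
elim/quotW=> w; rewrite pres_inv_pi pres_mul_pi; exact/pres_piP/word_mulV.
Qed.

Lemma pres_mulVg : left_inverse pres_one pres_inv pres_mul.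
Proof.
elim/quotW=> w; rewrite pres_inv_pi pres_mul_pi; apply/pres_piP.
by rewrite -{2}[w]word_invK; exact: word_mulV.
Qed.

HB.instance Definition _ := isGroup.Build presented
  pres_mulA pres_mul1g pres_mulg1 pres_mulVg pres_mulgV.

End Presentation.

(* The product (x.y)(i) = x (y i); the product of {perm _} in the library
   composes in the other order. *)
Definition pmul n (x y : 'S_n) : 'S_n := (y * x)%g.

Lemma pmulE n (x y : 'S_n) i : pmul x y i = x (y i).
Proof. exact: permM. Qed.

Lemma pmulA n : associative (@pmul n).
Proof. by move=> x y z; rewrite /pmul mulgA. Qed.
Lemma pmul1x n : left_id 1%g (@pmul n).
Proof. by move=> x; rewrite /pmul mulg1. Qed.
Lemma pmulx1 n : right_id 1%g (@pmul n).
Proof. by move=> x; rewrite /pmul mul1g. Qed.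
HB.instance Definition _ n :=
  Monoid.isLaw.Build 'S_n 1%g (@pmul n) (@pmulA n) (@pmul1x n) (@pmulx1 n).

Section ExtendedSymmetricGroup.
Variable n : nat.

Definition ord_lo (k : 'I_n.-1) : 'I_n := widen_ord (leq_pred n) k.

Lemma ord_hi_subproof (k : 'I_n.-1) : (k.+1 < n)%N.
Proof. by case: n k => [|m] [k ltk]. Qed.
Definition ord_hi (k : 'I_n.-1) : 'I_n := Ordinal (ord_hi_subproof k).

(* [None] is the generator z, [Some k] is the lift of the transposition of k
   and k + 1, for 0 <= k <= n - 2. *)
Definition tgen := option 'I_n.-1.

Local Notation lz := ((None : tgen), false).
Local Notation lt k := ((Some k : tgen), false).

Inductive trel : word tgen -> word tgen -> Prop :=
| trel_zz : trel [:: lz; lz] [::]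
| trel_zt k : trel [:: lz; lt k] [:: lt k; lz]
| trel_tt k : trel [:: lt k; lt k] [:: lz]
| trel_far (i j : 'I_n.-1) : ((i.+1 < j) || (j.+1 < i))%N ->
    trel [:: lt i; lt j] [:: lz; lt j; lt i]
| trel_braid (i j : 'I_n.-1) : j = i.+1 :> nat ->
    trel [:: lt i; lt j; lt i] [:: lt j; lt i; lt j].

Definition tS := presented trel.
HB.instance Definition _ := Group.on tS.
HB.instance Definition _ : EqQuotient (word tgen) (pres_eqb trel) tS :=
  EqQuotient.on tS.

Definition tz : tS := \pi_tS [:: lz].
Definition ttau (k : 'I_n.-1) : tS := \pi_tS [:: lt k].

Definition letter_perm (l : tgen * bool) : 'S_n :=
  if l.1 is Some k then
    if l.2 then (tperm (ord_lo k) (ord_hi k))^-1%g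
    else tperm (ord_lo k) (ord_hi k)
  else 1%g.

Definition word_perm (w : word tgen) : 'S_n :=
  \big[@pmul n/1%g]_(l <- w) letter_perm l.

Definition tproj (g : tS) : 'S_n := word_perm (repr g).

Lemma word_perm_cat (v w : word tgen) :
  word_perm (v ++ w) = pmul (word_perm v) (word_perm w).
Proof. by rewrite /word_perm big_cat. Qed.

Lemma word_perm_rel (v w : word tgen) : trel v w -> word_perm v = word_perm w.
Proof.
have E l u : word_perm (l :: u) = (word_perm u * letter_perm l)%g.
  by rewrite /word_perm big_cons.
have N : word_perm [::] = 1%g by rewrite /word_perm big_nil.
case=> [|k|k|i j ij|i j ij]; rewrite !E !N /letter_perm /= ?(mulg1, mul1g) //.
- exact: tperm2.
- by rewrite [LHS]conjgC tpermJ !tpermD // -val_eqE /=; lia.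
- have ei : ord_hi i = ord_lo j by apply/val_inj; rewrite /= ij.
  have J (a b : 'I_n) (s : 'S_n) :
      (tperm a b * s * tperm a b)%g = (s ^ tperm a b)%g.
    by rewrite /conjg tpermV mulgA.
  rewrite !J !tpermJ ei tpermL tpermR !tpermD //.
  all: by rewrite -val_eqE /=; lia.
Qed.

Lemma word_perm_compat (v w : word tgen) :
  pres_eq trel v w -> word_perm v = word_perm w.
Proof.
elim=> {v w} // [u v w _ -> _ -> //|u v w1 w2 _ E|a e|v w /word_perm_rel//].
  by rewrite !word_perm_cat E.
rewrite /word_perm !big_cons big_nil /letter_perm /pmul /=.
by case: a => [k|]; case: e; rewrite /= ?(mulgV, mulVg, mulg1, mul1g).
Qed.

Lemma tproj_pi (w : word tgen) : tproj (\pi_tS w) = word_perm w.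
Proof. exact/word_perm_compat/pres_repr. Qed.

Lemma tprojM (g h : tS) : tproj (g * h)%g = pmul (tproj g) (tproj h).
Proof.
elim/quotW: g => u; elim/quotW: h => v.
by rewrite [(_ * _)%g](pres_mul_pi trel u v) !tproj_pi word_perm_cat.
Qed.

Lemma tproj_ttau k : tproj (ttau k) = tperm (ord_lo k) (ord_hi k).
Proof. by rewrite tproj_pi /word_perm big_cons big_nil /pmul mul1g. Qed.

Lemma tproj_z : tproj tz = 1%g.
Proof. by rewrite tproj_pi /word_perm big_cons big_nil /pmul mul1g. Qed.

End ExtendedSymmetricGroup.

Section SectionAndCocycle.
Variable n : nat.

(* ttau k with a natural number index k <= n - 2 *)
Definition ttau_nat (k : nat) : tS n :=
  if insub k : option 'I_n.-1 is Some k' then ttau k' else 1%g.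

(* For i < j, the product of the ttau_k over k = i, ..., j-1, j-2, ..., i. *)
Definition ttau_up (i j : nat) : tS n :=
  (\prod_(k <- iota i (j - i) ++ rev (iota i (j.-1 - i))) ttau_nat k)%g.

Definition ttau2 (i j : 'I_n) : tS n :=
  if (i < j)%N then ttau_up i j
  else if (j < i)%N then (tz n * ttau_up j i)%g else 1%g.

Definition is_decomposition (x : 'S_n) (f : {ffun 'I_n -> 'I_n}) : bool :=
  [forall k, (f k <= k)%N] && (x == \big[@pmul n/1%g]_(k < n) tperm (f k) k).

(* Every permutation has exactly one decomposition, so the default value is
   not reached. *)
Definition tsection (x : 'S_n) : tS n :=
  if [pick f | is_decomposition x f] is Some f
  then (\prod_(k < n) ttau2 (f k) k)%g else 1%g.

(* The sign (-1)^b is encoded by the boolean b, and iota sends it to z^b;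
   such a b exists and is unique because tS is a central extension of the
   symmetric group by {1, z}. *)
Definition iota_sign (b : bool) : tS n := if b then tz n else 1%g.

Definition cocycle (x y : 'S_n) : int :=
  if [pick b : bool | (tsection x * tsection y ==
                       iota_sign b * tsection (pmul x y))%g] is Some b
  then (-1) ^+ b else 1.

End SectionAndCocycle.

Definition square n := ('I_n * 'I_n)%type.

(* A square is given by its column and its row, i.e. by its bottom left
   corner.  As there are n markings of each kind, injectivity means that every
   column (row) contains exactly one of them. *)
Record grid_diagram (n : nat) := GridDiagram {
  Xmark : 'I_n -> square n;
  Omark : 'I_n -> square n;
  Xmark_column : injective (fun k => (Xmark k).1);
  Xmark_row : injective (fun k => (Xmark k).2);
  Omark_column : injective (fun k => (Omark k).1);
  Omark_row : injective (fun k => (Omark k).2);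
  marks_disjoint : forall j k, Xmark j != Omark k }.

(* [inl k] is X_k and [inr k] is O_k. *)
Definition marking n := ('I_n + 'I_n)%type.

Definition marking_square n (G : grid_diagram n) (u : marking n) : square n :=
  match u with inl k => Xmark G k | inr k => Omark G k end.

(* The segments of the link join the two markings of each row and of each
   column. *)
Definition link_adj n (G : grid_diagram n) : rel (marking n) := fun u v =>
  ((marking_square G u).1 == (marking_square G v).1) ||
  ((marking_square G u).2 == (marking_square G v).2).

Record component_numbering n (G : grid_diagram n) (l : nat) :=
  ComponentNumbering {
    component : marking n -> 'I_l;
    component_onto : forall i, exists u, component u = i;
    componentP : forall u v,
      (component u == component v) = connect (link_adj G) u v }.

Definition point := (rat * rat)%type.

Definition chain := {malg rat[point]}.

Definition Icount (a b : chain) : rat :=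
  \sum_(p <- supp a) \sum_(q <- supp b)
    a@_p * b@_q * ((p.1 < q.1) && (p.2 < q.2))%:R.

Definition Jcount (a b : chain) : rat := (Icount a b + Icount b a) / 2.

Definition perm_chain n (x : 'S_n) : chain :=
  \sum_(i < n) << ((i : nat)%:R, (x i : nat)%:R) >>.

Definition center n (sq : square n) : point :=
  ((sq.1 : nat)%:R + 2^-1, (sq.2 : nat)%:R + 2^-1).

Section Gradings.
Variables (n l : nat) (G : grid_diagram n) (c : component_numbering G l).

Definition X_chain : chain := \sum_(k < n) << center (Xmark G k) >>.
Definition O_chain : chain := \sum_(k < n) << center (Omark G k) >>.

Definition Xi_chain (i : 'I_l) : chain :=
  \sum_(k < n | component c (inl k) == i) << center (Xmark G k) >>.
Definition Oi_chain (i : 'I_l) : chain :=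
  \sum_(k < n | component c (inr k) == i) << center (Omark G k) >>.

(* There is one horizontal segment for each O. *)
Definition num_horizontal (i : 'I_l) : nat :=
  #|[set k | component c (inr k) == i]|.

Definition maslov (x : 'S_n) : rat :=
  Jcount (perm_chain x - O_chain) (perm_chain x - O_chain) + 1.

Definition alexander (x : 'S_n) (i : 'I_l) : rat :=
  Jcount (perm_chain x - 2^-1 *: (X_chain + O_chain)) (Xi_chain i - Oi_chain i)
  - ((num_horizontal i)%:R - 1) / 2.

Definition U_maslov : rat := - 2.
Definition U_alexander (k : 'I_n) (i : 'I_l) : rat :=
  if component c (inr k) == i then - 1 else 0.

(* Degree and level of the generator U^m x. *)
Definition mono_maslov (m : multinom n) (x : 'S_n) : rat :=
  maslov x + \sum_(k < n) (m k)%:R * U_maslov.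
Definition mono_alexander (m : multinom n) (x : 'S_n) (i : 'I_l) : rat :=
  alexander x i + \sum_(k < n) (m k)%:R * U_alexander k i.

End Gradings.

(* The ring Z[U_(O_1), ..., U_(O_n)]; the variable U_(O_k) is 'X_k.  (The
   notations {mpoly _[_]} and 'X_{1..n} are also claimed by monalg.) *)
Notation Lambda n := (mpoly.mpoly n int).

Definition cyc_oo (a b k : nat) : bool :=
  if (a < b)%N then (a < k < b)%N else (a < k)%N || (k < b)%N.
Definition cyc_co (a b k : nat) : bool :=
  if (a < b)%N then (a <= k < b)%N else (a <= k)%N || (k < b)%N.

Section Rectangles.
Variable n : nat.
Implicit Types (x y : 'S_n) (g h : tS n) (r : 'I_n * 'I_n).

(* The pair r = (i, j) with i != j stands for the rectangle with bottom left
   corner (i, x i) and top right corner (j, x j). *)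
Definition rect_empty x r : bool :=
  [forall k : 'I_n,
    ~~ (cyc_oo r.1 r.2 k && cyc_oo (x r.1) (x r.2) (x k))].

Definition Rect0 x y : {set 'I_n * 'I_n} :=
  [set r | [&& r.1 != r.2, y == pmul x (tperm r.1 r.2) & rect_empty x r]].

Definition tRect0 g h : {set 'I_n * 'I_n} :=
  [set r | [&& r.1 != r.2, h == (g * ttau2 r.1 r.2)%g
             & rect_empty (tproj g) r]].

Definition horizontally_torn r : bool := (r.2 < r.1)%N.
Definition rect_eps r : int := if horizontally_torn r then - 1 else 1.

Variable G : grid_diagram n.

(* A marking is at the centre of its square, so the interior of the rectangle
   meets the squares of columns i, ..., j - 1 and rows x i, ..., x j - 1. *)
Definition O_count x r (k : 'I_n) : nat :=
  cyc_co r.1 r.2 (Omark G k).1 && cyc_co (x r.1) (x r.2) (Omark G k).2.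

Definition U_rect x r : Lambda n := \prod_(k < n) 'X_k ^+ O_count x r k.

End Rectangles.

Lemma fsum_by_target (V : zmodType) (T : choiceType) (I : finType)
    (P : pred I) (t : I -> T) (F : I -> T -> V) :
  \sum_(h \in [set: T]) \sum_(r | P r && (h == t r)) F r h =
  \sum_(r | P r) F r (t r).
Proof.
rewrite (@fsbigTE _ _ _ T [fset t r | r in {: I}]%fset).
  rewrite (exchange_big_dep P) => [|h r _ /andP[]//]; apply: eq_bigr => r Pr.
  rewrite big_mkcond (bigD1_seq (t r)) ?fset_uniq /= ?Pr ?eqxx //.
    by rewrite big1 ?addr0 // => h /negPf->.
  by apply/imfsetP; exists r.
move=> h hA; apply: big1 => r /andP[_ /eqP eh]; case/negP: hA.
by rewrite eh; apply/imfsetP; exists r.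
Qed.

Section LinearExtension.
Variables (R : nzRingType) (K : choiceType) (V : lmodType R) (F : K -> V).

Definition lin_ext (f : {malg R[K]}) : V := \sum_(k <- supp f) f@_k *: F k.

Lemma lin_extEw (f : {malg R[K]}) (d : {fset K}) :
  {subset supp f <= d} -> lin_ext f = \sum_(k <- d) f@_k *: F k.
Proof.
move=> fd; rewrite /lin_ext [RHS](bigID (mem (supp f))) /=.
rewrite [X in _ + X]big1 ?addr0; last first.
  by move=> k kf; rewrite mcoeff_outdom // scale0r.
rewrite -[RHS]big_filter; apply: perm_big; apply: uniq_perm.
- exact: fset_uniq.
- by rewrite filter_uniq ?fset_uniq.
- by move=> k; rewrite mem_filter; case: (boolP (k \in supp f)) => // /fd ->.
Qed.

Lemma lin_ext_is_linear : linear lin_ext.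
Proof.
move=> a f g; pose d := (supp f `|` supp g)%fset.
have fd : {subset supp f <= d} by move=> k kf; rewrite in_fsetU kf.
have gd : {subset supp g <= d} by move=> k kg; rewrite in_fsetU kg orbT.
rewrite (lin_extEw fd) (lin_extEw gd) (@lin_extEw _ d).
  rewrite scaler_sumr -big_split /=; apply: eq_bigr => k _.
  by rewrite monalg.mcoeffD monalg.mcoeffZ scalerDl scalerA.
move=> k; rewrite -monalg.mcoeff_neq0 monalg.mcoeffD monalg.mcoeffZ; apply: contraR => kd.
by rewrite !mcoeff_outdom ?mulr0 ?addr0 //; apply: contra kd; [exact: gd|exact: fd].
Qed.

HB.instance Definition _ :=
  GRing.isLinear.Build R {malg R[K]} V *:%R lin_ext lin_ext_is_linear.

Lemma lin_extU k : lin_ext << k >> = F k.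
Proof.
rewrite (@lin_extEw _ [fset k]%fset) ?big_seq_fset1 ?monalg.mcoeffUU ?scale1r //.
by move=> j; rewrite monalg.msuppU oner_eq0.
Qed.

Lemma lin_extUD j k : lin_ext (<< j >> + << k >>) = F j + F k.
Proof. by rewrite linearD /= !lin_extU. Qed.

End LinearExtension.

Section GeneratedSubmodule.
Variables (R : nzRingType) (V : lmodType R) (I : Type) (F : I -> V).

Definition submod_gen : {pred V} := fun v =>
  `[< exists s : seq (R * I), v = \sum_(t <- s) t.1 *: F t.2 >].

Lemma submod_gen_closed : submod_closed submod_gen.
Proof.
split=> [|a f g /asboolP[s ->] /asboolP[t ->]]; apply/asboolP.
  by exists [::]; rewrite big_nil.
exists ([seq (a * u.1, u.2) | u <- s] ++ t).
rewrite big_cat big_map scaler_sumr; congr (_ + _).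
by apply: eq_bigr => u _; rewrite scalerA.
Qed.

Lemma submod_gen_mem i : F i \in submod_gen.
Proof. by apply/asboolP; exists [:: (1, i)]; rewrite big_seq1 scale1r. Qed.

Lemma submod_gen_sum (J : Type) (r : seq J) (P : pred J) (u : J -> V) :
  (forall j, P j -> u j \in submod_gen) ->
  \sum_(j <- r | P j) u j \in submod_gen.
Proof.
have [h0 hD] := submod_gen_closed; move=> hu; elim/big_ind: _ => // v w hv hw.
by rewrite -[v]scale1r; exact: hD.
Qed.

Lemma submod_gen_scale a v : v \in submod_gen -> a *: v \in submod_gen.
Proof.
have [h0 hD] := submod_gen_closed; move=> hv; rewrite -[_ *: _]addr0.
exact: hD.
Qed.

Lemma submod_gen_stable (d : {linear V -> V}) :
  (forall i, d (F i) \in submod_gen) ->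
  forall v, v \in submod_gen -> d v \in submod_gen.
Proof.
move=> hF v /asboolP[s ->]; rewrite linear_sum; apply: submod_gen_sum => t _.
by rewrite linearZ; apply: submod_gen_scale.
Qed.

End GeneratedSubmodule.

Section QuotientModule.
Variables (R : nzRingType) (V : lmodType R) (N0 : {pred V}).
Variable N0_closed : submod_closed N0.

Definition submod_pred of submod_closed N0 : {pred V} := N0.
HB.instance Definition _ :=
  GRing.isSubmodClosed.Build R V (submod_pred N0_closed) N0_closed.
Local Notation N := (submod_pred N0_closed).

Definition quot_mod := Quotient.quot N.
HB.instance Definition _ := GRing.Zmodule.on quot_mod.
HB.instance Definition _ := ZmodQuotient.on quot_mod.

Definition quot_pi (v : V) : quot_mod := \pi_quot_mod v.

Lemma quot_piP (v w : V) : quot_pi v = quot_pi w <-> v - w \in N.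
Proof.
by split=> [/eqP|h]; [|apply/eqP]; rewrite /quot_pi -Quotient.idealrBE.
Qed.

Lemma quot_pi_repr (q : quot_mod) : quot_pi (repr q) = q.
Proof. exact: reprK. Qed.

Lemma quot_piD : {morph quot_pi : v w / v + w}.
Proof. by move=> v w; rewrite /quot_pi raddfD. Qed.

Definition quot_scale (a : R) (q : quot_mod) : quot_mod :=
  quot_pi (a *: repr q).

Lemma quot_scale_pi a v : quot_scale a (quot_pi v) = quot_pi (a *: v).
Proof.
by apply/quot_piP; rewrite -scalerBr rpredZ //; apply/quot_piP/quot_pi_repr.
Qed.

Lemma quot_scaleA a b q : quot_scale a (quot_scale b q) = quot_scale (a * b) q.
Proof. by rewrite -[q]quot_pi_repr !quot_scale_pi scalerA. Qed.
Lemma quot_scale1 : left_id 1 quot_scale.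
Proof. by move=> q; rewrite -[q]quot_pi_repr quot_scale_pi scale1r. Qed.
Lemma quot_scaleDr : right_distributive quot_scale +%R.
Proof.
move=> a p q; rewrite -[p]quot_pi_repr -[q]quot_pi_repr -quot_piD.
by rewrite !quot_scale_pi scalerDr quot_piD.
Qed.
Lemma quot_scaleDl q : {morph quot_scale^~ q : a b / a + b}.
Proof.
by move=> a b; rewrite -[q]quot_pi_repr !quot_scale_pi scalerDl quot_piD.
Qed.

HB.instance Definition _ := GRing.Zmodule_isLmodule.Build R quot_mod
  quot_scaleA quot_scale1 quot_scaleDr quot_scaleDl.

Lemma quot_pi_is_linear : linear quot_pi.
Proof. by move=> a v w; rewrite quot_piD -quot_scale_pi. Qed.
HB.instance Definition _ :=
  GRing.isLinear.Build R V quot_mod *:%R quot_pi quot_pi_is_linear.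

Variables (d : {linear V -> V}) (dN : forall v, v \in N -> d v \in N).

Definition quot_map of (forall v, v \in N -> d v \in N) :=
  fun q : quot_mod => quot_pi (d (repr q)).

Lemma quot_map_pi v : quot_map dN (quot_pi v) = quot_pi (d v).
Proof.
by apply/quot_piP; rewrite -linearB; apply/dN/quot_piP/quot_pi_repr.
Qed.

Lemma quot_map_is_linear : linear (quot_map dN).
Proof.
move=> a p q; rewrite -[p]quot_pi_repr -[q]quot_pi_repr -linearP !quot_map_pi.
by rewrite !linearP.
Qed.
HB.instance Definition _ := GRing.isLinear.Build R quot_mod quot_mod *:%R
  (quot_map dN) quot_map_is_linear.

End QuotientModule.

(* The differential, the homogeneous parts and the parts of level at most a,
   for an l-tuple of levels a.  That the differential squares to zero is not a
   field: it is a property of [Ctilde] below, and [filtered_isomorphic]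
   transports it. *)
Record filtered_complex (R : nzRingType) (l : nat) := FilteredComplex {
  chains : lmodType R;
  differential : {linear chains -> chains};
  graded_part : rat -> set chains;
  filtered_part : ('I_l -> rat) -> set chains }.

Arguments differential {R l} _.
Arguments graded_part {R l} _ _ _.
Arguments filtered_part {R l} _ _ _.

Definition filtered_isomorphic R l (C D : filtered_complex R l) : Prop :=
  exists f : {linear chains C -> chains D},
    [/\ bijective f,
        forall v, f (differential C v) = differential D (f v),
        forall d v, graded_part C d v <-> graded_part D d (f v)
      & forall a v, filtered_part C a v <-> filtered_part D a (f v)].

Section Complexes.
Variables (n l : nat) (G : grid_diagram n) (c : component_numbering G l).

(* The additive span of the generators U^m k that satisfy P m k. *)
Definition generated_part (K : choiceType) (P : multinom n -> K -> Prop) :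
    set {malg (Lambda n)[K]} :=
  [set f | forall k m, m \in mpoly.msupp (f@_k) -> P m k].

Definition free_graded_part (K : choiceType) (p : K -> 'S_n) (d : rat) :=
  generated_part (fun m (k : K) => mono_maslov G m (p k) = d).
Definition free_filtered_part (K : choiceType) (p : K -> 'S_n)
    (a : 'I_l -> rat) :=
  generated_part (fun m (k : K) => forall i, mono_alexander c m (p k) i <= a i).

Definition Cminus_diff (S : 'S_n -> 'S_n -> 'I_n * 'I_n -> int) (x : 'S_n) :
    {malg (Lambda n)['S_n]} :=
  \sum_(y : 'S_n) \sum_(r in Rect0 x y) ((S x y r)%:~R * U_rect G x r) *: << y >>.

Definition Cminus (S : 'S_n -> 'S_n -> 'I_n * 'I_n -> int) :
    filtered_complex (Lambda n) l :=
  {| chains := {malg (Lambda n)['S_n]};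
     differential := lin_ext (Cminus_diff S);
     graded_part := free_graded_part id;
     filtered_part := free_filtered_part id |}.

Local Notation free_tS := {malg (Lambda n)[tS n]}.

(* The elements z g + g; the quotient by the submodule they generate is the
   quotient by z + 1. *)
Definition z_plus_one (g : tS n) : free_tS := << (tz n * g)%g >> + << g >>.

Definition tdiff_gen (g : tS n) : free_tS :=
  \sum_(h \in [set: tS n]) \sum_(r in tRect0 g h) U_rect G (tproj g) r *: << h >>.

(* Grouping by targets can be dropped, since each rectangle has only one. *)
Lemma tdiff_genE g :
  tdiff_gen g =
  \sum_(r : 'I_n * 'I_n | (r.1 != r.2) && rect_empty (tproj g) r)
    U_rect G (tproj g) r *: << (g * ttau2 r.1 r.2)%g >>.
Proof.
rewrite -(fsum_by_target _ (fun r => g * ttau2 r.1 r.2)%g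
  (fun r h => U_rect G (tproj g) r *: << h >>)).
apply: eq_fsbigr => h _; apply: eq_bigl => r; rewrite inE.
by case: (r.1 != r.2) => //=; exact: andbC.
Qed.

Lemma tdiff_gen_z g :
  lin_ext tdiff_gen (z_plus_one g) \in submod_gen z_plus_one.
Proof.
rewrite lin_extUD !tdiff_genE tprojM tproj_z pmul1x.
rewrite -big_split /=; apply: submod_gen_sum => r _.
rewrite -scalerDr -mulgA; apply: submod_gen_scale.
exact: (submod_gen_mem z_plus_one).
Qed.

(* The grading and the filtration are the images of those of the free module. *)
Definition Ctilde : filtered_complex (Lambda n) l :=
  let zN := submod_gen_closed z_plus_one in
  {| chains := quot_mod zN;
     differential := quot_map (N0_closed := zN) (submod_gen_stable tdiff_gen_z);
     graded_part := fun d => quot_pi zN @` free_graded_part (@tproj n) d;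
     filtered_part := fun a => quot_pi zN @` free_filtered_part (@tproj n) a |}.

End Complexes.

(* Main.v *)
Require Import Defs.
From HB Require Import structures.
From mathcomp Require Import all_boot all_order all_algebra all_fingroup.
From mathcomp Require Import boolp classical_sets generic_quotient monalg mpoly.
From mathcomp Require Import zify ring.

(** The extension [tproj] of the symmetric group has two sheets, and [tsection]
    picks one point on each fibre.  So every [g] is uniquely [z^b s(x)] with
    [x = tproj g], and since [z] acts as [-1] on the quotient complex, the
    rule [g |-> (-1)^b x] identifies that complex with the free module on
    permutations; [x |-> s(x)] is its inverse ([signed_proj_section],
    [section_signed_proj]).  Degrees and levels only depend on [tproj g], so
    they are preserved in both directions ([generated_part_lin_ext]).

    For the differential, a rectangle [r = (i, j)] leads from [s(x)] to
    [s(x) t_ij].  By uniqueness of decompositions, [t_ij] is [s] of the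
    transposition if [i < j], and [z] times it if the rectangle is horizontally
    torn; the definition of the cocycle then turns [s(x) t_ij] into
    [eps(r) c(x, tau_ij) s(x tau_ij)] ([sheet_mul_ttau2]), which is the sign
    attached to the same rectangle on the other side.

    All this rests on the presentation defining a group of order exactly
    [2 n!], which has two halves.
    - [z] is not trivial ([tz_neq1]).  If [e_0, e_1, ...] anticommute and square
      to 1, then over the field with three elements the differences
      [e_k - e_(k+1)] satisfy the relations of the [t_k], with [z] acting
      as [-1]: indeed [(e_k - e_(k+1))^2 = 2 = -1].  Such [e_k] act on functions
      on sets of natural numbers.
    - The kernel of [tproj] is not larger than [{1, z}] ([ker_tproj]).
      Coxeter's coset enumeration writes every element, up to [z], as a product
      of [t_(i_k, k)] with [i_k <= k] ([normal_form]).  There are [n!] such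
      products, and they project onto all [n!] permutations, so the indices are
      determined by the permutation ([decomposition_unique]). *)

Set Implicit Arguments.
Unset Strict Implicit.
Unset Printing Implicit Defensive.

Import GRing.Theory.

Local Open Scope ring_scope.

(** * A representation in which z acts as -1 *)

(** Functions on sets of natural numbers, a set being encoded by its indicator
    function. *)
Definition spinor := (nat -> bool) -> 'F_3.

Definition flip (i : nat) (A : nat -> bool) : nat -> bool :=
  fun j => (j == i) (+) A j.
Definition parity (A : nat -> bool) (i : nat) : bool :=
  \big[addb/false]_(j < i) A j.

(** The Jordan-Wigner operators: the sign counts the elements of the set below
    [i], which makes different indices anticommute. *)
Definition clifford (i : nat) (u : spinor) : spinor :=
  fun A => (-1) ^+ parity A i * u (flip i A).

Definition spin_act (k : nat) (u : spinor) : spinor :=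
  fun A => clifford k u A - clifford k.+1 u A.

Definition spin_opp (u : spinor) : spinor := fun A => - u A.

Lemma flipK i : involutive (flip i).
Proof. by move=> A; apply/funext => j; rewrite /flip addbA addbb. Qed.

Lemma flipC i j A : flip i (flip j A) = flip j (flip i A).
Proof. by apply/funext => k; rewrite /flip addbCA. Qed.

Lemma parity_flip i j A : parity (flip i A) j = (i < j)%N (+) parity A j.
Proof.
elim: j => [|j IH]; first by rewrite /parity !big_ord0.
rewrite /parity !big_ord_recr /= -!/(parity _ _) IH /flip.
have -> : (i < j.+1)%N = (i < j)%N (+) (j == i) by case: ltngtP; lia.
by rewrite -!addbA; congr (_ (+) _); rewrite addbCA.
Qed.

Lemma cliffordK i u : clifford i (clifford i u) = u.
Proof.
apply/funext => A; rewrite /clifford flipK parity_flip ltnn /= mulrA.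
by rewrite -signr_addb addbb mul1r.
Qed.

(** Removing or adding the smaller index changes by one the number of elements
    below the larger index, and not conversely. *)
Lemma clifford_anti i j u A : i != j ->
  clifford i (clifford j u) A = - clifford j (clifford i u) A.
Proof.
move=> ij; rewrite /clifford !parity_flip flipC !mulrA -!signr_addb -mulNr.
by case: ltngtP ij => // _ _; congr (_ * _); do 2 case: (parity A _);
   rewrite /= ?expr0 ?expr1 ?opprK.
Qed.

Lemma cliffordB i u v A :
  clifford i (fun A => u A - v A) A = clifford i u A - clifford i v A.
Proof. by rewrite /clifford mulrBr. Qed.

Lemma spin_actE k l u A : spin_act k (spin_act l u) A =
  (clifford k (clifford l u) A - clifford k (clifford l.+1 u) A) -
  (clifford k.+1 (clifford l u) A - clifford k.+1 (clifford l.+1 u) A).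
Proof. by rewrite {1}/spin_act /spin_act !cliffordB. Qed.

Lemma addr3_F3 (a : 'F_3) : a + a + a = 0.
Proof.
have := mulrn_pchar (pchar_Fp (isT : prime 3)) a.
by rewrite !mulrS mulr0n addr0 addrA.
Qed.

Lemma addrr_F3 (a : 'F_3) : a + a = - a.
Proof. by apply/eqP; rewrite -addr_eq0 addr3_F3. Qed.

Lemma spin_act_sq k u : spin_act k (spin_act k u) = spin_opp u.
Proof.
apply/funext => A; rewrite spin_actE !cliffordK.
rewrite (@clifford_anti k.+1 k) ?(gtn_eqF (ltnSn k)) //.
by rewrite /spin_opp; transitivity (u A + u A); [ring | exact: addrr_F3].
Qed.

Lemma spin_act_far k l u : (k.+1 < l)%N || (l.+1 < k)%N ->
  spin_act k (spin_act l u) = spin_opp (spin_act l (spin_act k u)).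
Proof.
move=> kl; apply/funext => A; rewrite /spin_opp !spin_actE.
rewrite (@clifford_anti k l) ?(@clifford_anti k l.+1) ?(@clifford_anti k.+1 l)
  ?(@clifford_anti k.+1 l.+1); try by lia.
by ring.
Qed.

(** Writing [a] and [b] for two consecutive generators, this is [ab + ba = 1]:
    the only common operator is [e_(k+1)], with coefficients 1 and -1, so
    [ab + ba = -2 e_(k+1)^2 = -2], which is 1 modulo 3. *)
Lemma spin_act_next k u A :
  spin_act k (spin_act k.+1 u) A = u A - spin_act k.+1 (spin_act k u) A.
Proof.
rewrite !spin_actE !cliffordK (@clifford_anti k k.+1)
  ?(@clifford_anti k k.+2) ?(@clifford_anti k.+1 k.+2); try by lia.
(* both sides have the same clifford terms and differ by 3 u A *)
by rewrite -[RHS]subr0 -(addr3_F3 (u A)); ring.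
Qed.

Lemma spin_actB k u v :
  spin_act k (fun A => u A - v A) = fun A => spin_act k u A - spin_act k v A.
Proof. by apply/funext => A; rewrite /spin_act !cliffordB; ring. Qed.

Lemma opp_spin_act k u : spin_opp (spin_act k u) = spin_act k (spin_opp u).
Proof. by apply/funext => A; rewrite /spin_opp /spin_act /clifford; ring. Qed.

Lemma spin_oppK : involutive spin_opp.
Proof. by move=> u; apply/funext => A; rewrite /spin_opp opprK. Qed.

(** Both sides are [a + b], because [aba = a(1 - ab) = a + b] and
    [bab = b(1 - ba) = b + a]. *)
Lemma spin_act_braid k u :
  spin_act k (spin_act k.+1 (spin_act k u)) =
  spin_act k.+1 (spin_act k (spin_act k.+1 u)).
Proof.
have N : spin_act k.+1 (spin_act k u) =
    (fun A => u A - spin_act k (spin_act k.+1 u) A).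
  by apply/funext => A; rewrite spin_act_next; ring.
rewrite {1}N spin_actB spin_act_sq.
have -> : spin_act k (spin_act k.+1 u) =
    (fun A => u A - spin_act k.+1 (spin_act k u) A).
  by apply/funext => A; rewrite spin_act_next.
by rewrite spin_actB spin_act_sq; apply/funext => A; rewrite /spin_opp; ring.
Qed.

Section Representation.
Variable n : nat.

(** An inverse generator acts as the opposite of the generator, as the
    generators square to [-1]. *)
Definition letter_act (a : tgen n * bool) : spinor -> spinor :=
  if a.1 is Some k then
    if a.2 then fun u => spin_opp (spin_act k u) else spin_act k
  else spin_opp.

Definition word_act (w : word (tgen n)) (u : spinor) : spinor :=
  foldr letter_act u w.

Lemma word_act_compat v w : pres_eq (@trel n) v w -> word_act v =1 word_act w.
Proof.
elim=> {v w} //.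
- by move=> v w _ E x; rewrite E.
- by move=> u v w _ E1 _ E2 x; rewrite E1.
- by move=> u v w1 w2 _ E x; rewrite /word_act !foldr_cat -!/(word_act _ _) E.
- by move=> [k|] [] x; rewrite /= /letter_act /= -?opp_spin_act;
     rewrite ?spin_act_sq ?spin_oppK.
- move=> _ _ [|k|k|i j ij|i j ij] x; rewrite /= /letter_act /=.
  + exact: spin_oppK.
  + exact: opp_spin_act.
  + exact: spin_act_sq.
  + exact: spin_act_far.
  + by rewrite ij spin_act_braid.
Qed.

Lemma tz_neq1 : tz n <> 1%g.
Proof.
move=> /pres_piP /word_act_compat /(_ (fun=> 1)) /(congr1 (@^~ xpredT)).
by move/eqP.
Qed.

End Representation.

(** * Normal forms in the extended symmetric group *)

Section SpinGroup.
Variable n : nat.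
Local Open Scope quotient_scope.
Local Open Scope group_scope.
Implicit Types (g h : tS n) (k m : nat) (ws : seq nat).

Lemma tS_mul_pi (v w : word (tgen n)) :
  (\pi_(tS n) v : tS n) * \pi_(tS n) w = \pi_(tS n) (v ++ w).
Proof. exact: pres_mul_pi. Qed.

Lemma tS1E : 1 = \pi_(tS n) [::].
Proof. by []. Qed.

Lemma tz2 : tz n * tz n = 1.
Proof. by rewrite tS_mul_pi tS1E; apply/pres_piP/pres_rel/trel_zz. Qed.

Lemma ttau_sq (k : 'I_n.-1) : ttau k * ttau k = tz n.
Proof. by rewrite tS_mul_pi; apply/pres_piP/pres_rel/trel_tt. Qed.

Lemma tz_ttau (k : 'I_n.-1) : tz n * ttau k = ttau k * tz n.
Proof. by rewrite !tS_mul_pi; apply/pres_piP/pres_rel/trel_zt. Qed.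

(** The inverse of [t_k] is [z t_k], so words need no inverses. *)
Lemma letterE (a : tgen n * bool) :
  \pi_(tS n) [:: a] = match a with
    | (None, _) => tz n
    | (Some k, false) => ttau k
    | (Some k, true) => tz n * ttau k end.
Proof.
case: a => [a e]; have [->|] := eqVneq e false; first by case: a.
case: e => // _; apply: (mulIg (\pi_(tS n) [:: (a, false)])).
have -> : (\pi_(tS n) [:: (a, true)] : tS n) * \pi_(tS n) [:: (a, false)] = 1.
  by rewrite tS_mul_pi tS1E; apply/pres_piP/(pres_cancel _ a true).
case: a => [k|]; last by rewrite tz2.
by rewrite -mulgA ttau_sq tz2.
Qed.

Lemma pi_cons (a : tgen n * bool) w :
  \pi_(tS n) (a :: w) = \pi_(tS n) [:: a] * \pi_(tS n) w.
Proof. by rewrite tS_mul_pi. Qed.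

Lemma tzC g : tz n * g = g * tz n.
Proof.
elim/quotW: g; elim=> [|a w IH]; first by rewrite -tS1E mul1g mulg1.
rewrite pi_cons -mulgA -IH !mulgA; congr (_ * _).
rewrite letterE; case: a => [[k|] []] //; last exact: tz_ttau.
by rewrite -mulgA -tz_ttau.
Qed.

Local Notation sg := (iota_sign n).

Lemma iota_signM a b : sg a * sg b = sg (a (+) b).
Proof. by case: a b => [] []; rewrite /= ?mulg1 ?mul1g ?tz2. Qed.

Lemma iota_signC b g : sg b * g = g * sg b.
Proof. by case: b; rewrite /= ?mulg1 ?mul1g ?tzC. Qed.

Lemma iota_sign_inj a b g : sg a * g = sg b * g -> a = b.
Proof.
move/mulIg; case: a b => [] [] // E; case: (@tz_neq1 n) => //; exact: esym.
Qed.

Lemma tproj1 : tproj (1 : tS n) = 1.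
Proof. by rewrite tS1E tproj_pi /word_perm big_nil. Qed.

Lemma tproj_iota_sign b g : tproj (sg b * g) = tproj g.
Proof. by rewrite tprojM; case: b; rewrite /= ?tproj_z ?tproj1 pmul1x. Qed.

(** Equality in the quotient by [{1, z}], where the generators satisfy the
    Coxeter relations of the symmetric group. *)
Definition eq_mod_z g h := exists b, g = sg b * h.
Local Infix "===" := eq_mod_z (at level 70).

Lemma eq_mod_z_refl g : g === g.
Proof. by exists false; rewrite mul1g. Qed.

Lemma eq_mod_z_eq g h : g = h -> g === h.
Proof. by move->; exact: eq_mod_z_refl. Qed.

Lemma eq_mod_z_sym g h : g === h -> h === g.
Proof. by case=> b ->; exists b; rewrite mulgA iota_signM addbb mul1g. Qed.

Lemma eq_mod_z_trans h g g' : g === h -> h === g' -> g === g'.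
Proof. by case=> a -> [b ->]; exists (a (+) b); rewrite mulgA iota_signM. Qed.

Lemma eq_mod_zM g g' h h' : g === g' -> h === h' -> g * h === g' * h'.
Proof.
case=> a -> [b ->]; exists (a (+) b).
rewrite -iota_signM -!mulgA; congr (_ * _).
by rewrite !mulgA -(iota_signC b g').
Qed.

Lemma eq_mod_z_tproj g h : g === h -> tproj g = tproj h.
Proof. by case=> b ->; rewrite tproj_iota_sign. Qed.

Local Notation t := (ttau_nat n).

Lemma ttau_natE k (ltk : (k < n.-1)%N) : t k = ttau (Ordinal ltk).
Proof. by rewrite /ttau_nat insubT. Qed.

Lemma ttau_nat_out k : (n.-1 <= k)%N -> t k = 1.
Proof. by move=> kn; rewrite /ttau_nat insubN // -leqNgt. Qed.

Lemma ttau_nat_sq k : t k * t k === 1.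
Proof.
have [kn|nk] := ltnP k n.-1; last first.
  by rewrite ttau_nat_out // mulg1; exact: eq_mod_z_refl.
by exists true; rewrite ttau_natE ttau_sq mulg1.
Qed.

Lemma ttau_nat_far i j : (i.+1 < j)%N || (j.+1 < i)%N ->
  t i * t j === t j * t i.
Proof.
move=> ij.
have [ni|ni] := ltnP i n.-1; last first.
  by rewrite ttau_nat_out // mulg1 mul1g; exact: eq_mod_z_refl.
have [nj|nj] := ltnP j n.-1; last first.
  by rewrite (@ttau_nat_out j) // mulg1 mul1g; exact: eq_mod_z_refl.
exists true; rewrite !ttau_natE /=.
rewrite !(tS_mul_pi [:: _] [:: _]) (tS_mul_pi [:: _] [:: _; _]).
by apply/pres_piP/pres_rel/trel_far.
Qed.

Lemma ttau_nat_braid k : (k.+1 < n.-1)%N ->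
  t k * t k.+1 * t k = t k.+1 * t k * t k.+1.
Proof.
move=> kn; rewrite (ttau_natE kn) (ttau_natE (ltnW kn)).
rewrite !(tS_mul_pi [:: _] [:: _]) !(tS_mul_pi [:: _; _] [:: _]).
by apply/pres_piP/pres_rel/trel_braid.
Qed.

Definition tword ws : tS n := \prod_(k <- ws) t k.
Definition word_eq ws ws' := tword ws === tword ws'.
Local Infix "~~~" := word_eq (at level 70).

Lemma tword_cat ws ws' : tword (ws ++ ws') = tword ws * tword ws'.
Proof. by rewrite /tword big_cat. Qed.

Lemma tword1 k : tword [:: k] = t k.
Proof. by rewrite /tword big_seq1. Qed.

Lemma word_eq_refl ws : ws ~~~ ws.
Proof. exact: eq_mod_z_refl. Qed.

Lemma word_eq_trans ws2 ws1 ws3 : ws1 ~~~ ws2 -> ws2 ~~~ ws3 -> ws1 ~~~ ws3.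
Proof. exact: eq_mod_z_trans. Qed.

Lemma word_eq_cat v v' w w' : v ~~~ v' -> w ~~~ w' -> v ++ w ~~~ v' ++ w'.
Proof. by rewrite /word_eq !tword_cat; exact: eq_mod_zM. Qed.

Lemma word_eq_catl u v v' : v ~~~ v' -> u ++ v ~~~ u ++ v'.
Proof. exact: word_eq_cat (word_eq_refl u). Qed.

Lemma word_eq_catr u v v' : v ~~~ v' -> v ++ u ~~~ v' ++ u.
Proof. by move/word_eq_cat; apply; exact: word_eq_refl. Qed.

Lemma word_eq_sq k : [:: k; k] ~~~ [::].
Proof.
by rewrite /word_eq /tword !big_cons big_nil mulg1; exact: ttau_nat_sq.
Qed.

Lemma word_eq_braid k : (k.+1 < n.-1)%N ->
  [:: k.+1; k; k.+1] ~~~ [:: k; k.+1; k].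
Proof.
move=> kn; apply: eq_mod_z_eq; rewrite /tword !big_cons big_nil !mulg1.
by rewrite !mulgA (ttau_nat_braid kn).
Qed.

Lemma word_eq_far j ws : all (fun i => (i.+1 < j)%N || (j.+1 < i)%N) ws ->
  ws ++ [:: j] ~~~ j :: ws.
Proof.
elim: ws => [|i ws IH] /=; first by move=> _; exact: word_eq_refl.
case/andP=> ij /IH {}IH; apply: word_eq_trans (word_eq_catl [:: i] IH) _.
apply: (@word_eq_catr ws [:: i; j] [:: j; i]).
by rewrite /word_eq /tword !big_cons big_nil !mulg1; exact: ttau_nat_far.
Qed.

Lemma word_eq_revK ws : rev ws ++ ws ~~~ [::].
Proof.
elim: ws => [|k ws IH]; first exact: word_eq_refl.
rewrite rev_cons -cats1 -catA /=; apply: word_eq_trans IH.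
exact: word_eq_catl (@word_eq_catr ws [:: k; k] [::] (word_eq_sq k)).
Qed.

(** The word of [t_m ... t_i], empty for [i = m + 1].  The [m + 2] elements so
    obtained represent the cosets of the subgroup generated by
    [t_0, ..., t_(m-1)] in the one generated by [t_0, ..., t_m]. *)
Definition descent m i : seq nat := rev (iota i (m.+1 - i)).

Lemma descentS m i : (i <= m)%N -> descent m i = rcons (descent m i.+1) i.
Proof. by move=> im; rewrite /descent subSn //= rev_cons subSS. Qed.

Lemma descent_cat m i j : (i <= j <= m)%N ->
  descent m i = descent m j.+1 ++ descent j i.
Proof.
case/andP=> ij jm; rewrite /descent -rev_cat; congr rev.
rewrite (_ : (m.+1 - i = (j.+1 - i) + (m.+1 - j.+1))%N); last by lia.
by rewrite iotaD subnKC //; lia.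
Qed.

Lemma descent_head m i : (i <= m)%N -> descent m i = m :: rev (iota i (m - i)).
Proof.
by move=> im; rewrite /descent subSn // -addn1 iotaD rev_cat /= subnKC.
Qed.

Lemma all_descent (P : pred nat) m i :
  (forall k, (i <= k <= m)%N -> P k) -> all P (descent m i).
Proof.
move=> h; apply/allP=> k; rewrite mem_rev mem_iota => ik; apply: h; lia.
Qed.

(** The cosets are stable under right multiplication.  If [j = i - 1] or
    [j = i], the descent gets longer or shorter.  If [j < i - 1], then [t_j]
    commutes with it.  If [j > i], then [t_j] moves left up to the factor
    [t_j t_(j-1)], where the braid relation makes it a [t_(j-1)] that
    commutes with the remaining factors on its left. *)
Lemma descent_step m i j : (i <= m.+1)%N -> (j <= m)%N -> (m < n.-1)%N ->
  exists ws i', [/\ all (fun k => k < m)%N ws, (i' <= m.+1)%N &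
    descent m i ++ [:: j] ~~~ ws ++ descent m i'].
Proof.
move=> im jm mn; have [E|[E|[lt|lt]]] :
  j.+1 = i \/ j = i \/ (j.+1 < i)%N \/ (i < j)%N by lia.
- exists [::], j; split=> //; first by lia.
  by rewrite cats1 -E -descentS //; exact: word_eq_refl.
- exists [::], i.+1; split=> //; first by lia.
  rewrite -E descentS // -cats1 -catA -[X in _ ~~~ X]cats0.
  exact: word_eq_catl (word_eq_sq j).
- exists [:: j], i; split=> //=; first by rewrite andbT; lia.
  by apply: word_eq_far; apply: all_descent => k; lia.
case: j jm lt => // j jm lt.
(* from here on, the generator is t_(j+1), and it comes out as t_j *)
exists [:: j], i; split=> //=; first by rewrite andbT; lia.
set R := rev (iota i (j - i)).
have -> : descent m i = descent m j.+2 ++ [:: j.+1; j] ++ R.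
  rewrite (@descent_cat m i j.+1); last by lia.
  rewrite (@descent_head j.+1 i (ltnW lt)) -/(descent j i).
  by rewrite (@descent_head j i lt).
rewrite -!catA.
apply: (@word_eq_trans (descent m j.+2 ++ [:: j.+1; j; j.+1] ++ R)).
  apply: word_eq_catl; apply: (word_eq_catl [:: j.+1; j]); apply: word_eq_far.
  by apply/allP=> k; rewrite mem_rev mem_iota; lia.
apply: (@word_eq_trans (descent m j.+2 ++ [:: j; j.+1; j] ++ R)).
  by apply/word_eq_catl/word_eq_catr/word_eq_braid; lia.
apply: (@word_eq_trans ((descent m j.+2 ++ [:: j]) ++ [:: j.+1; j] ++ R)).
  by rewrite -catA; exact: word_eq_refl.
by apply/(word_eq_catr _ (word_eq_far _))/all_descent => k; lia.
Qed.

Lemma coset_form m ws : (m < n.-1)%N -> all (fun k => k <= m)%N ws ->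
  exists ws' i, [/\ all (fun k => k < m)%N ws', (i <= m.+1)%N &
    ws ~~~ ws' ++ descent m i].
Proof.
move=> mn; elim/last_ind: ws => [|ws j IH].
  move=> _; exists [::], m.+1; split=> //; rewrite /descent subnn.
  exact: word_eq_refl.
rewrite all_rcons => /andP[jm /IH[ws' [i [ws'm im E]]]].
have [ws2 [i' [ws2m im' E2]]] := descent_step im jm mn.
exists (ws' ++ ws2), i'; split; rewrite ?all_cat ?ws'm //.
rewrite -cats1; apply: word_eq_trans (word_eq_catr _ E) _.
by rewrite -!catA; exact: word_eq_catl.
Qed.

(** The lift of the transposition of [i] and [m + 1] lies in the same coset as
    the descent, so it may serve as a representative instead: it is
    [t_i ... t_(m-1)] times the descent. *)
Lemma descent_up m i : (i <= m.+1)%N ->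
  tword (descent m i) === tword (rev (iota i (m - i))) * ttau_up n i m.+1.
Proof.
rewrite /ttau_up -/(tword _) -tword_cat catA leq_eqVlt => /orP[/eqP->|im].
  by rewrite /descent subnn (_ : m - m.+1 = 0)%N; [exact: eq_mod_z_refl|lia].
apply/eq_mod_z_sym.
rewrite descent_head // subSn // -addn1 iotaD subnKC // catA.
exact: word_eq_catr (@word_eq_catr [:: m] _ [::] (word_eq_revK _)).
Qed.

(** Split off the coset of the largest generator and use induction on the rest.
    With [i <= k], [ttau_up i k] agrees with [ttau2 i k], including
    [ttau_up k k = 1]. *)
Lemma normal_form_words m ws : (m < n)%N -> all (fun k => k < m)%N ws ->
  exists f : nat -> nat, (forall k, f k <= k)%N /\
    tword ws === \prod_(0 <= k < m.+1) ttau_up n (f k) k.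
Proof.
elim: m ws => [|m IH] ws mn wsm.
  exists id; split=> //; rewrite big_nat1.
  by case: ws wsm => // _; exact: eq_mod_z_refl.
have mn' : (m < n.-1)%N by lia.
have [ws' [i [ws'm im E]]] := coset_form mn' wsm.
have [|f [fk Ef]] := IH (ws' ++ rev (iota i (m - i))) (ltnW mn).
  rewrite all_cat ws'm; apply/allP=> k; rewrite mem_rev mem_iota; lia.
exists (fun k => if k == m.+1 then i else f k); split.
  by move=> k; case: eqP => [->|].
rewrite big_nat_recr //= eqxx.
have -> : \prod_(0 <= k < m.+1) ttau_up n (if k == m.+1 then i else f k) k =
          \prod_(0 <= k < m.+1) ttau_up n (f k) k.
  by apply: eq_big_nat => k /andP[_ km]; rewrite (ltn_eqF km).
apply: eq_mod_z_trans E _; rewrite tword_cat.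
apply: eq_mod_z_trans (eq_mod_zM (eq_mod_z_refl _) (descent_up im)) _.
by rewrite mulgA -tword_cat; exact: eq_mod_zM (eq_mod_z_refl _).
Qed.

Lemma word_form g : exists ws, all (fun k => k < n.-1)%N ws /\ g === tword ws.
Proof.
elim/quotW: g; elim=> [|a w [ws [wsn E]]].
  by exists [::]; split=> //; rewrite /tword big_nil; exact: eq_mod_z_refl.
have [ws' [ws'n E']] : exists ws', all (fun k => k < n.-1)%N ws' /\
    \pi_(tS n) [:: a] === tword ws'.
  rewrite letterE; case: a => [[k|] e].
    exists [:: nat_of_ord k]; rewrite /= ltn_ord tword1 ttau_natE; split=> //.
    have -> : Ordinal (ltn_ord k) = k by exact/val_inj.
    by case: e; [exists true|exists false; rewrite mul1g].
  exists [::]; split=> //; exists true; rewrite /tword big_nil mulg1 //.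
exists (ws' ++ ws); rewrite all_cat ws'n wsn pi_cons tword_cat.
by split=> //; exact: eq_mod_zM.
Qed.

Lemma normal_form g : exists f : {ffun 'I_n -> 'I_n},
  (forall k : 'I_n, f k <= k)%N /\ g === \prod_(k < n) ttau2 (f k) k.
Proof.
have T2 (i j : 'I_n) : (i <= j)%N -> ttau2 i j = ttau_up n i j.
  rewrite /ttau2; case: ltngtP => // ij _.
  rewrite /ttau_up ij subnn (_ : (j.-1 - j = 0)%N) /= ?big_nil //; lia.
have [ws [wsn E]] := word_form g.
have [f [fk Ef]] : exists f : nat -> nat, (forall k, f k <= k)%N /\
    tword ws === \prod_(0 <= k < n) ttau_up n (f k) k.
  case: (posnP n) => n0.
    exists id; split=> //; rewrite big_geq ?n0 //.
    case: ws wsn {E} => [_|k ws] /=; last by case/andP; lia.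
    by rewrite /tword big_nil; exact: eq_mod_z_refl.
  have n0' : (n.-1 < n)%N by lia.
  have := normal_form_words n0' wsn.
  by rewrite prednK.
exists [ffun k : 'I_n => Ordinal (leq_ltn_trans (fk k) (ltn_ord k))]; split.
  by move=> k; rewrite ffunE /=.
apply: eq_mod_z_trans E (eq_mod_z_trans Ef _); rewrite big_mkord.
apply/eq_mod_z_eq/eq_bigr => p _.
by rewrite T2 ffunE /=.
Qed.

End SpinGroup.

(** * Decompositions, the section and the cocycle *)

Lemma big_single (T : Type) (idx : T) (op : Monoid.law idx) (I : finType)
    (F : I -> T) (j : I) :
  (forall k, k != j -> F k = idx) -> \big[op/idx]_k F k = F j.
Proof.
move=> F1; rewrite -[RHS](big_pred1_eq op) [RHS]big_mkcond.
by apply: eq_bigr => k _; case: ifPn => // /F1.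
Qed.

Section SectionAndSheets.
Variable n : nat.
Local Open Scope group_scope.
Implicit Types (g h : tS n) (x y : 'S_n) (i j k : 'I_n).
Local Infix "===" := (@eq_mod_z n) (at level 70).

Lemma ttau_upS (i j : nat) : (i.+1 < j)%N ->
  ttau_up n i j = ttau_nat n i * ttau_up n i.+1 j * ttau_nat n i.
Proof.
move=> ij; rewrite /ttau_up !big_cat /= -!mulgA.
rewrite (_ : (j - i = (j - i.+1).+1)%N) 
  1?(_ : (j.-1 - i = (j.-1 - i.+1).+1)%N); try by lia.
by rewrite /= big_cons rev_cons big_rcons /= !mulgA.
Qed.

Lemma tproj_ttau_up i j : (i < j)%N -> tproj (ttau_up n i j) = tperm i j.
Proof.
have T (k k' : 'I_n) : k' = k.+1 :> nat -> tproj (ttau_nat n k) = tperm k k'.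
  move=> kk'; have kn : (k < n.-1)%N by have := ltn_ord k'; lia.
  by rewrite (ttau_natE kn) tproj_ttau; congr (tperm _ _); apply/val_inj.
move: {2}(j - i)%N (leqnn (j - i)) => d; elim: d i => [|d IH] i; first by lia.
move=> ijd; rewrite leq_eqVlt => /orP[/eqP ij|ij].
  by rewrite /ttau_up -ij subSnn /= subnn big_seq1 (@T i j).
have i1n : (i.+1 < n)%N by exact: ltn_trans (ltn_ord j).
rewrite ttau_upS // !tprojM (@T i (Ordinal i1n)) //.
rewrite (IH (Ordinal i1n)) //=; last by lia.
(* conjugation by (i, i + 1) moves (i + 1, j) to (i, j) *)
rewrite /pmul mulgA -{1}(tpermV i) -mulgA -/(conjg _ _) tpermJ tpermR tpermD //.
  by rewrite -val_eqE /=; lia.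
by rewrite -val_eqE /=; lia.
Qed.

Lemma tproj_ttau2 i j : tproj (ttau2 i j) = tperm i j.
Proof.
rewrite /ttau2; case: ltngtP => [ij|ji|/val_inj->].
- exact: tproj_ttau_up.
- by rewrite tprojM tproj_z pmul1x tproj_ttau_up // tpermC.
- by rewrite tproj1 tperm1.
Qed.

Lemma tproj_prod (I : Type) (r : seq I) (F : I -> tS n) :
  tproj (\prod_(a <- r) F a) = \big[@pmul n/1]_(a <- r) tproj (F a).
Proof. exact: (big_morph _ (@tprojM n) (@tproj1 n)). Qed.

Lemma tproj_surj x : exists g, tproj g = x.
Proof.
have [ts -> _] := prod_tpermP x; elim: ts => [|[i j] ts [g E]].
  by exists 1; rewrite tproj1 big_nil.
by exists (g * ttau2 i j); rewrite tprojM tproj_ttau2 E big_cons.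
Qed.

Lemma decomposition_form g : exists2 f, is_decomposition (tproj g) f &
  g === \prod_(k < n) ttau2 (f k) k.
Proof.
have [f [fk E]] := normal_form g; exists f => //.
apply/andP; split; first exact/forallP.
rewrite (eq_mod_z_tproj E) tproj_prod; apply/eqP/eq_bigr => k _.
by rewrite tproj_ttau2.
Qed.

Lemma decomposition_exists x : exists f, is_decomposition x f.
Proof.
by have [g <-] := tproj_surj x; have [f fd _] := decomposition_form g; exists f.
Qed.

Lemma card_decompositions :
  #|[set f : {ffun 'I_n -> 'I_n} | [forall k, (f k <= k)%N]]| = n`!.
Proof.
transitivity #|family (fun k : 'I_n => [pred i : 'I_n | (i <= k)%N])|.
  by apply: eq_card => f; rewrite inE; apply: eq_forallb => k.
rewrite card_family foldrE big_map big_enum /= fact_prod big_add1 /= big_mkord.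
apply: eq_bigr => k _.
rewrite -sum1_card (@big_ord_narrow _ _ _ k.+1 n (fun=> 1%N) (ltn_ord k)).
by rewrite sum1_card card_ord.
Qed.

(** Decompositions are as many as permutations, and each permutation has one:
    a surjection between finite sets of the same size is injective. *)
Lemma decomposition_unique x f f' :
  is_decomposition x f -> is_decomposition x f' -> f = f'.
Proof.
pose D := [set f : {ffun 'I_n -> 'I_n} | [forall k, (f k <= k)%N]].
pose dec (f : {ffun 'I_n -> 'I_n}) := \big[@pmul n/1]_(k < n) tperm (f k) k.
have DT : dec @: D =i 'S_n.
  move=> y; rewrite inE; apply/imsetP.
  by have [e /andP[eD /eqP ey]] := decomposition_exists y;
     exists e; rewrite ?inE.
have /imset_injP inj : #|dec @: D| == #|D|.
  by rewrite (eq_card DT) card_Sn card_decompositions.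
move=> /andP[fD /eqP xf] /andP[f'D /eqP xf']; apply: inj; rewrite ?inE //.
by rewrite /dec -xf.
Qed.

(** Both normal forms decompose the same permutation, so they have the same
    indices. *)
Lemma ker_tproj g h : tproj g = tproj h -> g === h.
Proof.
move=> E; have [f fd Ef] := decomposition_form g.
have [e ed Ee] := decomposition_form h; rewrite -E in ed.
rewrite -(decomposition_unique fd ed) in Ee.
exact: eq_mod_z_trans Ef (eq_mod_z_sym Ee).
Qed.

Lemma tproj_tsection x : tproj (tsection x) = x.
Proof.
rewrite /tsection; case: pickP => [f /andP[_ /eqP E]|no]; last first.
  by have [f] := decomposition_exists x; rewrite no.
by rewrite [RHS]E tproj_prod; apply: eq_bigr => k _; rewrite tproj_ttau2.
Qed.

(** All factors of the decomposition of the transposition are trivial, except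
    the one of index [j]. *)
Lemma tsection_tperm i j : (i < j)%N -> tsection (tperm i j) = ttau2 i j.
Proof.
move=> ij; pose f := [ffun k => if k == j then i else k].
have fj k : k != j -> f k = k by rewrite ffunE => /negPf->.
have fd : is_decomposition (tperm i j) f.
  apply/andP; split.
    by apply/forallP=> k; rewrite ffunE; case: eqP => // ->; exact: ltnW.
  rewrite (@big_single _ _ _ _ _ j) ?ffunE ?eqxx // => k /fj->.
  exact: tperm1.
rewrite /tsection; case: pickP => [e ed|/(_ f)]; last by rewrite fd.
rewrite (decomposition_unique ed fd) (@big_single _ _ _ _ _ j) ?ffunE ?eqxx //.
by move=> k /fj->; rewrite /ttau2 ltnn.
Qed.

(** The exponent [b] of [g = z^b s(x)]. *)
Definition sheet g : bool := g != tsection (tproj g).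

Lemma sheetP g : g = iota_sign n (sheet g) * tsection (tproj g).
Proof.
rewrite /sheet; case: eqP => /= [<-|ne]; first by rewrite mul1g.
have [[] //] : g === tsection (tproj g).
  by apply: ker_tproj; rewrite tproj_tsection.
by rewrite /= mul1g.
Qed.

Lemma sheet_section b x : sheet (iota_sign n b * tsection x) = b.
Proof.
have := sheetP (iota_sign n b * tsection x).
by rewrite tproj_iota_sign tproj_tsection => /iota_sign_inj.
Qed.

Lemma sheet_mul_sign b g : sheet (iota_sign n b * g) = b (+) sheet g.
Proof. by rewrite {1}[g]sheetP mulgA iota_signM sheet_section. Qed.

Lemma cocycleE x y :
  cocycle x y = ((-1) ^+ sheet (tsection x * tsection y)%g)%R.
Proof.
have E := sheetP (tsection x * tsection y).
rewrite tprojM !tproj_tsection in E.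
rewrite /cocycle.
case: pickP => [b /eqP|/(_ (sheet (tsection x * tsection y)))].
  by rewrite {1}E => /iota_sign_inj ->.
by rewrite -E eqxx.
Qed.

(** The comparison of signs: multiplication by [ttau2 i j] changes the sheet
    by the sign assigned to the rectangle [(i, j)].  The factor [z] in [ttau2]
    for [j < i] accounts for [rect_eps], the failure of [s] to be a morphism
    for the cocycle. *)
Lemma sheet_mul_ttau2 g i j : i != j ->
  ((-1) ^+ sheet (g * ttau2 i j)%g =
   (-1) ^+ sheet g * (rect_eps (i, j) * cocycle (tproj g) (tperm i j))
   :> int)%R.
Proof.
move=> nij; rewrite cocycleE /rect_eps /horizontally_torn /=.
have -> : (if (j < i)%N then -1 else 1 : int)%R = ((-1) ^+ (j < i)%N)%R.
  by case: ifP.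
have E : ttau2 i j = iota_sign n (j < i)%N * tsection (tperm i j).
  case: (ltngtP i j) nij => [ij _|ji _|/val_inj ->]; last by rewrite eqxx.
    by rewrite tsection_tperm // mul1g.
  by rewrite tpermC tsection_tperm // /ttau2 ji ltnNge (ltnW ji).
rewrite -!signr_addb -!sheet_mul_sign; congr (_ ^+ nat_of_bool (sheet _))%R.
by rewrite {1}[g]sheetP E -!mulgA; congr (_ * _); rewrite !mulgA iota_signC.
Qed.

End SectionAndSheets.

(** * The isomorphism of filtered complexes *)

Lemma lin_ext_gens (R : nzRingType) (K : choiceType) (V : lmodType R)
    (h : {linear {malg R[K]} -> V}) v :
  h v = lin_ext (fun k => h << k >>) v.
Proof.
rewrite {1}[v]monalgE linear_sum; apply: eq_bigr => k _.
by rewrite -linearZ; congr (h _); apply/malgP => j;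
   rewrite monalg.mcoeffZ !monalg.mcoeffU mulrnAr mulr1.
Qed.

Lemma eq_linear_gens (R : nzRingType) (K : choiceType) (V : lmodType R)
    (h h' : {linear {malg R[K]} -> V}) :
  (forall k, h << k >> = h' << k >>) -> h =1 h'.
Proof.
move=> E v; rewrite (lin_ext_gens h) (lin_ext_gens h').
by apply: eq_bigr => k _; rewrite E.
Qed.

(** A signed map between generators cannot create monomials: one that occurs in
    the image at [p k] occurs in the source at some generator above it. *)
Lemma generated_part_lin_ext n (K L : choiceType) (b : K -> bool) (p : K -> L)
    (P : multinom n -> K -> Prop) (Q : multinom n -> L -> Prop) v :
  (forall m k, P m k -> Q m (p k)) -> generated_part P v ->
  generated_part Q (lin_ext (fun k => (-1) ^+ b k *: << p k >>) v).
Proof.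
move=> PQ Pv j m; apply: contraPP => nQ; apply/negP; rewrite mcoeff_msupp negbK.
rewrite /lin_ext (raddf_sum (monalg.mcoeff j)) (raddf_sum (mpoly.mcoeff m)) /=.
apply/eqP/big1 => k _; rewrite monalg.mcoeffZ monalg.mcoeffZ monalg.mcoeffU.
case: eqP => [pk|_]; last by rewrite mulr0n !mulr0 mpoly.mcoeff0.
have k0 : mpoly.mcoeff m (monalg.mcoeff k v) = 0.
  apply/eqP; rewrite -[_ == 0]negbK -mcoeff_msupp; apply/negP => /Pv/PQ.
  by rewrite pk.
by rewrite mulr1 mulrC mulr_sign; case: (b k); rewrite ?mpoly.mcoeffN k0 ?oppr0.
Qed.

Section Isomorphism.
Variable n : nat.
Local Notation Lam := (Lambda n).
Local Notation zspan := (submod_gen_closed (@z_plus_one n)).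

Definition signed_proj (g : tS n) : {malg Lam['S_n]} :=
  (-1) ^+ sheet g *: << tproj g >>.

(** The sign [(-1) ^+ false] is 1; it gives the map the shape of
    [generated_part_lin_ext]. *)
Definition section_gen (x : 'S_n) : {malg Lam[tS n]} :=
  (-1) ^+ false *: << tsection x >>.

Lemma signed_proj_z g : lin_ext signed_proj (z_plus_one g) = 0.
Proof.
rewrite lin_extUD /signed_proj tprojM tproj_z pmul1x (@sheet_mul_sign n true).
by rewrite signrN scaleNr addNr.
Qed.

Lemma signed_proj_submod v :
  v \in submod_gen (@z_plus_one n) -> lin_ext signed_proj v = 0.
Proof.
move/asboolP=> [s ->]; rewrite linear_sum big1 // => t _.
by rewrite linearZ /= signed_proj_z scaler0.
Qed.

Definition quot_signed_proj (q : quot_mod zspan) : {malg Lam['S_n]} :=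
  lin_ext signed_proj (repr q).

Lemma quot_signed_proj_pi v :
  quot_signed_proj (quot_pi zspan v) = lin_ext signed_proj v.
Proof.
apply/eqP; rewrite -subr_eq0 -linearB; apply/eqP/signed_proj_submod.
by apply/(quot_piP zspan); rewrite quot_pi_repr.
Qed.

Lemma quot_signed_proj_is_linear : linear quot_signed_proj.
Proof.
move=> a p q; rewrite -[p]quot_pi_repr -[q]quot_pi_repr -linearP.
by rewrite !quot_signed_proj_pi linearP.
Qed.
HB.instance Definition _ :=
  GRing.isLinear.Build Lam (quot_mod zspan) {malg Lam['S_n]} *:%R
    quot_signed_proj quot_signed_proj_is_linear.

Lemma signed_proj_section w : lin_ext signed_proj (lin_ext section_gen w) = w.
Proof.
apply: (@eq_linear_gens _ _ _ (lin_ext signed_proj \o lin_ext section_gen)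
  idfun) => x /=.
rewrite lin_extU /section_gen scale1r lin_extU /signed_proj tproj_tsection.
by rewrite /sheet tproj_tsection eqxx scale1r.
Qed.

Lemma quot_pi_z g : quot_pi zspan << (tz n * g)%g >> = - quot_pi zspan << g >>.
Proof.
apply/eqP; rewrite -addr_eq0 -linearD; apply/eqP.
rewrite -[RHS](linear0 (quot_pi zspan)); apply/quot_piP.
by rewrite subr0; exact: submod_gen_mem.
Qed.

Lemma section_signed_proj v :
  quot_pi zspan (lin_ext section_gen (lin_ext signed_proj v)) =
  quot_pi zspan v.
Proof.
apply: (@eq_linear_gens _ _ _
  (quot_pi zspan \o (lin_ext section_gen \o lin_ext signed_proj))
  (quot_pi zspan)) => g /=.
rewrite lin_extU /signed_proj linearZ /= lin_extU linearZ /=.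
rewrite /section_gen scale1r.
rewrite {3}[g]sheetP; case: sheet => /=; last by rewrite scale1r mul1g.
by rewrite quot_pi_z scaleN1r.
Qed.

Lemma quot_signed_proj_bij : bijective quot_signed_proj.
Proof.
exists (fun w => quot_pi zspan (lin_ext section_gen w)) => [q|w].
  by rewrite -[q]quot_pi_repr quot_signed_proj_pi section_signed_proj.
by rewrite quot_signed_proj_pi signed_proj_section.
Qed.

Local Notation S := (fun x y r => rect_eps r * cocycle x (pmul x^-1%g y)).

(** The sum over pairs of a target and a rectangle is one over rectangles, as
    the target is determined; there [x^-1 . y] is the transposition. *)
Lemma Cminus_diffE (G : grid_diagram n) x : Cminus_diff G S x =
  \sum_(r : 'I_n * 'I_n | (r.1 != r.2) && rect_empty x r)
   ((rect_eps r * cocycle x (tperm r.1 r.2))%:~R * U_rect G x r) *: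
     << pmul x (tperm r.1 r.2) >>.
Proof.
rewrite /Cminus_diff.
under eq_bigr => y _ do under eq_bigl => r do rewrite inE.
rewrite (exchange_big_dep
  (fun r : 'I_n * 'I_n => (r.1 != r.2) && rect_empty x r)) /=; last first.
  by move=> y r _ /and3P[-> _ ->].
apply: eq_bigr => r /andP[r12 rx]; rewrite (big_pred1 (pmul x (tperm r.1 r.2))).
  by rewrite /pmul mulgK.
by move=> y; rewrite /= r12 rx andbT.
Qed.

Lemma signed_proj_diff (G : grid_diagram n) v :
  lin_ext signed_proj (lin_ext (tdiff_gen G) v) =
  lin_ext (Cminus_diff G S) (lin_ext signed_proj v).
Proof.
apply: (@eq_linear_gens _ _ _ (lin_ext signed_proj \o lin_ext (tdiff_gen G))
   (lin_ext (Cminus_diff G S) \o lin_ext signed_proj)) => g /=.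
rewrite !lin_extU /signed_proj linearZ /= lin_extU.
rewrite tdiff_genE Cminus_diffE linear_sum scaler_sumr.
apply: eq_bigr => r /andP[r12 _]; rewrite linearZ /= lin_extU.
rewrite /signed_proj tprojM tproj_ttau2 !scalerA.
have E : (-1) ^+ sheet (g * ttau2 r.1 r.2)%g = (-1) ^+ sheet g *
    (rect_eps r * cocycle (tproj g) (tperm r.1 r.2))%:~R :> Lam.
  have := congr1 (fun a : int => a%:~R : Lam) (sheet_mul_ttau2 g r12).
  by rewrite -surjective_pairing [RHS]rmorphM !rmorph_sign.
by rewrite E mulrC -mulrA.
Qed.

Lemma quot_signed_proj_part (P : multinom n -> 'S_n -> Prop) q :
  (quot_pi zspan @` generated_part (fun m g => P m (tproj g)))%classic q <->
  generated_part P (quot_signed_proj q).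
Proof.
split=> [[v Pv <-]|Pq].
  by rewrite quot_signed_proj_pi; apply: generated_part_lin_ext Pv.
exists (lin_ext section_gen (quot_signed_proj q)); last first.
  by rewrite -{2}[q]quot_pi_repr section_signed_proj quot_pi_repr.
apply: (generated_part_lin_ext _ Pq) => m x.
by rewrite tproj_tsection.
Qed.

Lemma quot_signed_proj_diff (l : nat) (G : grid_diagram n)
    (c : component_numbering G l) q :
  quot_signed_proj (differential (Ctilde c) q) =
  differential (Cminus c S) (quot_signed_proj q).
Proof.
rewrite -[q]quot_pi_repr /= quot_map_pi !quot_signed_proj_pi.
exact: signed_proj_diff.
Qed.

End Isomorphism.

Theorem proposition5p3 (n l : nat) (G : grid_diagram n)
    (c : component_numbering G l) :
  filtered_isomorphic (Ctilde c)
    (Cminus c (fun x y r => rect_eps r * cocycle x (pmul x^-1%g y))).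
Proof.
exists (@quot_signed_proj n); split.
- exact: quot_signed_proj_bij.
- exact: quot_signed_proj_diff.
- by move=> d q; exact: quot_signed_proj_part.
- by move=> a q; exact: quot_signed_proj_part.
Qed.
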